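(* Let $C\subset\mathbb{O}$ be a real linear subspace of dimension $4$. Then $C$ is an $\mathbb{H}$-Lagrangian linear subspace of $\mathbb{O}$ if and only if $C$ is a Cayley subspace of $\mathbb{O}$.
   Context: $\mathbb{O}$ is the algebra of octonions with its standard inner product; $\operatorname{Im}\mathbb{O}=1^{\perp}$. For a unit $u\in\operatorname{Im}\mathbb{O}$ let $J_u:\mathbb{O}\to\mathbb{O}$, $J_u(y)=yu$. A real $4$-dimensional subspace $C\subset\mathbb{O}$ is $\mathbb{H}$-Lagrangian if there is a real linear subspace $L\subset\operatorname{Im}\mathbb{O}$ with $\dim L=4$ such that $J_uC\perp C$ for every unit $u\in L$. $Spin(7)\subset SO(8)=SO(\mathbb{O})$ denotes the group of linear isometries $g$ of $\mathbb{O}$ for which there is $\theta_g\in SO(\mathbb{O})$ with $g(vx)=g(v)\theta_g(x)$ for all $v,x\in\mathbb{O}$. Write $\mathbb{O}=\mathbb{H}\oplus\mathbb{H}$ by the Cayley--Dickson construction. A (unoriented) Cayley subspace of $\mathbb{O}$ is a $4$-dimensional real subspace of the form $g(\mathbb{H}\times\{0\})$ for some $g\in Spin(7)$. *)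

(* Defs.v *)
From HB Require Import structures.
From mathcomp Require Import all_boot all_order all_algebra.
From mathcomp Require Import reals.
Set Implicit Arguments.
Unset Strict Implicit.
Unset Printing Implicit Defensive.
Import Order.TTheory GRing.Theory Num.Theory.
Local Open Scope ring_scope.

(* Cayley-Dickson doubling, with the convention
   (a, b)(c, d) = (a c - d^* b, d a + b c^* ) and (a, b)^* = (a^*, - b).
   Starting from R with the trivial conjugation it yields successively the
   complex numbers, the quaternions and the octonions. *)
Section CayleyDickson.
Variables (V : zmodType) (mul : V -> V -> V) (conj : V -> V).

Definition cd_conj (p : V * V) : V * V := (conj p.1, - p.2).

Definition cd_mul (p q : V * V) : V * V :=
  (mul p.1 q.1 - mul (conj q.2) p.2, mul q.2 p.1 + mul p.2 (conj q.1)).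

End CayleyDickson.

Definition cd_dot (R : nmodType) (V : Type) (dot : V -> V -> R)
  (p q : V * V) : R := dot p.1 q.1 + dot p.2 q.2.

Section Octonions.
Variable R : realType.

Definition cplx : vectType R := (R^o * R^o)%type.
Definition quaternion : vectType R := (cplx * cplx)%type.
Definition octonion : vectType R := (quaternion * quaternion)%type.

Definition cplx_conj : cplx -> cplx := @cd_conj R id.
Definition cplx_mul : cplx -> cplx -> cplx := @cd_mul R *%R id.
Definition quat_conj : quaternion -> quaternion := cd_conj cplx_conj.
Definition quat_mul : quaternion -> quaternion -> quaternion :=
  cd_mul cplx_mul cplx_conj.
Definition oct_mul : octonion -> octonion -> octonion :=
  cd_mul quat_mul quat_conj.

(* Sum over the eight real coordinates. *)
Definition oct_dot : octonion -> octonion -> R :=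
  cd_dot (cd_dot (cd_dot *%R)).

Definition oct_one : octonion := (((1, 0), (0, 0)), ((0, 0), (0, 0))).

Definition oct_imag (x : octonion) : Prop := oct_dot oct_one x = 0.

Definition oct_unit (x : octonion) : Prop := oct_dot x x = 1.

Definition oct_J (u y : octonion) : octonion := oct_mul y u.

Definition Hlagrangian (C : {vspace octonion}) : Prop :=
  \dim C = 4%N /\
  exists L : {vspace octonion},
    [/\ \dim L = 4%N,
        forall u, u \in L -> oct_imag u
      & forall u, u \in L -> oct_unit u ->
          forall x y, x \in C -> y \in C -> oct_dot (oct_J u x) y = 0].

Definition oct_isometry (g : 'End(octonion)) : Prop :=
  forall x y, oct_dot (g x) (g y) = oct_dot x y.

(* The determinant does not depend on the basis, here the library's [vbasis]. *)
Definition oct_det (g : 'End(octonion)) : R :=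
  \det (passmx.mxof (vbasis {:octonion}) (vbasis {:octonion}) g).

Definition SO8 (g : 'End(octonion)) : Prop :=
  oct_isometry g /\ oct_det g = 1.

Definition Spin7 (g : 'End(octonion)) : Prop :=
  SO8 g /\
  exists2 theta : 'End(octonion), SO8 theta &
    forall v x, g (oct_mul v x) = oct_mul (g v) (theta x).

Definition quat_inl (h : quaternion) : octonion := (h, 0).

Fact quat_inl_linear : linear quat_inl.
Proof. by move=> a x y; apply: injective_projections; rewrite //= scaler0 addr0. Qed.

HB.instance Definition _ :=
  GRing.isLinear.Build R quaternion octonion _ quat_inl quat_inl_linear.

Definition quat_space : {vspace octonion} := limg (linfun quat_inl).

Lemma mem_quat_space (x : octonion) : (x \in quat_space) = (x.2 == 0).
Proof.
apply/memv_imgP/eqP => [[h _ ->]|]; first by rewrite lfunE.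
by case: x => h k /= ->; exists h; rewrite ?memvf// lfunE.
Qed.

Definition cayley (C : {vspace octonion}) : Prop :=
  \dim C = 4%N /\ exists2 g, Spin7 g & C = (g @: quat_space)%VS.

End Octonions.

(* Main.v *)
(* For a unit imaginary [a], the right multiplication [R_a] belongs to Spin(7),
   with companion [theta_a x = - (a x) a] by the right Moufang identity; on
   [Im O] this is minus the reflection in the hyperplane [a^perp].  If [C] is
   H-Lagrangian for [L], then [conj x C] is orthogonal to [L] for every [x] in
   [C], so for [x <> 0] it is the same four-dimensional space [D], and
   [C D <= C].  Products of [R_a]'s move [D] to [H x 0], since reflections take
   any orthonormal 3-frame to [i, j, k].  Once [C (H x 0) <= C], the operator
   [R_k R_j R_i] acts on [H + H] as [(-1, 1)] and splits [C], which is therefore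
   [H x 0] or [0 x H]; right multiplication by [(0, 1)] exchanges
   these.  Conversely [g (H x 0)] is H-Lagrangian for [theta_g (0 x H)]. *)
Require Import Defs.
From HB Require Import structures.
From mathcomp Require Import all_boot all_order all_algebra.
From mathcomp Require Import reals.
From mathcomp Require Import ring lra.
Set Implicit Arguments.
Unset Strict Implicit.
Unset Printing Implicit Defensive.
Import Order.TTheory GRing.Theory Num.Theory.
Local Open Scope ring_scope.

(* Locked, so that rewriting with the coordinate lemmas below never unfolds
   octonion operations to pairs. *)
HB.lock Definition Oct (R : realType) (a0 a1 a2 a3 a4 a5 a6 a7 : R)
  : octonion R := (((a0, a1), (a2, a3)), ((a4, a5), (a6, a7))).
Canonical Oct_unlockable := Unlockable Oct.unlock.

(** * Octonions in eight real coordinates *)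

Section OctonionAlgebra.
Variable R : realType.
Implicit Types (x y : octonion R) (k : R).

Local Notation "x ∘ y" := (oct_mul x y) (at level 40, left associativity).
Local Notation "⟨ x , y ⟩" := (oct_dot x y) (at level 0).
Local Notation "1o" := (oct_one R).

(** View for case analysis: it exposes the coordinates under the locked [Oct] instead of as nested
    pairs. *)
Variant oct_spec : octonion R -> Type :=
  OctSpec a0 a1 a2 a3 a4 a5 a6 a7 : oct_spec (Oct a0 a1 a2 a3 a4 a5 a6 a7).

Lemma octP x : oct_spec x.
Proof.
case: x => [[[a0 a1] [a2 a3]] [[a4 a5] [a6 a7]]].
by move: (OctSpec a0 a1 a2 a3 a4 a5 a6 a7); rewrite unlock.
Qed.

Definition oct_conj : octonion R -> octonion R := cd_conj (@quat_conj R).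

Section Coordinates.
Variables a0 a1 a2 a3 a4 a5 a6 a7 : R.
Variables b0 b1 b2 b3 b4 b5 b6 b7 : R.
Local Notation α := (Oct a0 a1 a2 a3 a4 a5 a6 a7).
Local Notation β := (Oct b0 b1 b2 b3 b4 b5 b6 b7).

Lemma oct_addE : α + β =
  Oct (a0 + b0) (a1 + b1) (a2 + b2) (a3 + b3)
    (a4 + b4) (a5 + b5) (a6 + b6) (a7 + b7).
Proof. by rewrite unlock. Qed.

Lemma oct_oppE : - α =
  Oct (- a0) (- a1) (- a2) (- a3) (- a4) (- a5) (- a6) (- a7).
Proof. by rewrite unlock. Qed.

Lemma oct_scaleE k : k *: α =
  Oct (k * a0) (k * a1) (k * a2) (k * a3) (k * a4) (k * a5) (k * a6) (k * a7).
Proof. by rewrite unlock. Qed.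

Lemma oct_conjE : oct_conj α =
  Oct a0 (- a1) (- a2) (- a3) (- a4) (- a5) (- a6) (- a7).
Proof. by rewrite unlock. Qed.

Lemma oct_zeroE : 0 = Oct 0 0 0 0 0 0 0 0 :> octonion R.
Proof. by rewrite unlock. Qed.

Lemma oct_oneE : 1o = Oct 1 0 0 0 0 0 0 0.
Proof. by rewrite unlock. Qed.

Lemma oct_mulE : α ∘ β = Oct
    (a0 * b0 - a1 * b1 - a2 * b2 - a3 * b3
      - a4 * b4 - a5 * b5 - a6 * b6 - a7 * b7)
    (a0 * b1 + a1 * b0 + a2 * b3 - a3 * b2
      + a4 * b5 - a5 * b4 - a6 * b7 + a7 * b6)
    (a0 * b2 - a1 * b3 + a2 * b0 + a3 * b1
      + a4 * b6 + a5 * b7 - a6 * b4 - a7 * b5)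
    (a0 * b3 + a1 * b2 - a2 * b1 + a3 * b0
      + a4 * b7 - a5 * b6 + a6 * b5 - a7 * b4)
    (a0 * b4 - a1 * b5 - a2 * b6 - a3 * b7
      + a4 * b0 + a5 * b1 + a6 * b2 + a7 * b3)
    (a0 * b5 + a1 * b4 - a2 * b7 + a3 * b6
      - a4 * b1 + a5 * b0 - a6 * b3 + a7 * b2)
    (a0 * b6 + a1 * b7 + a2 * b4 - a3 * b5
      - a4 * b2 + a5 * b3 + a6 * b0 - a7 * b1)
    (a0 * b7 - a1 * b6 + a2 * b5 + a3 * b4
      - a4 * b3 - a5 * b2 + a6 * b1 + a7 * b0).
Proof.
rewrite unlock.
rewrite /oct_mul /quat_mul /cplx_mul /quat_conj /cplx_conj /cd_mul /cd_conj /=.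
by congr ((_, _), (_, _), ((_, _), (_, _))); rewrite /=; ring.
Qed.

Lemma oct_dotE : ⟨α, β⟩ =
  a0 * b0 + a1 * b1 + a2 * b2 + a3 * b3 + a4 * b4 + a5 * b5 + a6 * b6 + a7 * b7.
Proof. by rewrite unlock /oct_dot /cd_dot /=; ring. Qed.

End Coordinates.

Definition oct_coordE :=
  (oct_addE, oct_oppE, oct_scaleE, oct_conjE, oct_oneE, oct_mulE, oct_dotE).

End OctonionAlgebra.

Ltac oct_case x := case: (octP x) => [? ? ? ? ? ? ? ?].

Ltac oct_ring := do ?rewrite oct_coordE; try congr Oct; ring.

(** * Linearity, norm, alternative and Moufang identities, checked as polynomial identities in the
    coordinates *)

Section Identities.
Variable R : realType.
Implicit Types (x y z u v a b : octonion R) (k : R).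

Local Notation "x ∘ y" := (oct_mul x y) (at level 40, left associativity).
Local Notation "⟨ x , y ⟩" := (oct_dot x y) (at level 0).
Local Notation "1o" := (oct_one R).

Lemma oct_dotPr a k x y : ⟨a, k *: x + y⟩ = k * ⟨a, x⟩ + ⟨a, y⟩.
Proof. by oct_case a; oct_case x; oct_case y; oct_ring. Qed.

Lemma oct_dot_linear a : linear (oct_dot a : octonion R -> R^o).
Proof. exact: oct_dotPr. Qed.

HB.instance Definition _ a :=
  GRing.isLinear.Build R (octonion R) R^o _ (oct_dot a) (oct_dot_linear a).

Lemma oct_mul_linear a : linear (oct_mul a).
Proof. by move=> k x y; oct_case a; oct_case x; oct_case y; oct_ring. Qed.

HB.instance Definition _ a :=
  GRing.isLinear.Build R (octonion R) (octonion R) _ (oct_mul a)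
    (oct_mul_linear a).

Lemma oct_J_linear a : linear (oct_J a).
Proof.
by move=> k x y; rewrite /oct_J; oct_case a; oct_case x; oct_case y; oct_ring.
Qed.

HB.instance Definition _ a :=
  GRing.isLinear.Build R (octonion R) (octonion R) _ (oct_J a)
    (oct_J_linear a).

Lemma oct_conj_linear : linear (@oct_conj R).
Proof. by move=> k x y; oct_case x; oct_case y; oct_ring. Qed.

HB.instance Definition _ :=
  GRing.isLinear.Build R (octonion R) (octonion R) _ (@oct_conj R)
    oct_conj_linear.

Lemma oct_dotC x y : ⟨x, y⟩ = ⟨y, x⟩.
Proof. by oct_case x; oct_case y; oct_ring. Qed.

Lemma oct_dotZr k x y : ⟨x, k *: y⟩ = k * ⟨x, y⟩.
Proof. by oct_case x; oct_case y; oct_ring. Qed.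

Lemma oct_dotZl k x y : ⟨k *: x, y⟩ = k * ⟨x, y⟩.
Proof. by rewrite oct_dotC oct_dotZr oct_dotC. Qed.

Lemma oct_dotDl x y z : ⟨x + y, z⟩ = ⟨x, z⟩ + ⟨y, z⟩.
Proof. by rewrite oct_dotC linearD /= !(oct_dotC z). Qed.

Lemma oct_dot_eq0 x : ⟨x, x⟩ = 0 -> x = 0.
Proof.
oct_case x; rewrite !oct_coordE oct_zeroE => h.
by congr Oct; nra.
Qed.

Lemma oct_dot_ge0 x : 0 <= ⟨x, x⟩.
Proof.
by oct_case x; rewrite !oct_coordE !addr_ge0 // -expr2 sqr_ge0.
Qed.

Lemma oct_conj_dot x : oct_conj x = (2 * ⟨1o, x⟩) *: 1o - x.
Proof. by oct_case x; oct_ring. Qed.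

Lemma oct_mulr1 x : x ∘ 1o = x.
Proof. by oct_case x; oct_ring. Qed.

Lemma oct_mulNl a x : - a ∘ x = - (a ∘ x).
Proof. by oct_case x; oct_case a; oct_ring. Qed.

Lemma oct_mul0 x : 0 ∘ x = 0.
Proof. by oct_case x; rewrite oct_zeroE; oct_ring. Qed.

Lemma oct_mulN1 x : - 1o ∘ x = - x.
Proof. by oct_case x; oct_ring. Qed.

Lemma oct_mulA_rr x a : (x ∘ a) ∘ a = x ∘ (a ∘ a).
Proof. by oct_case x; oct_case a; oct_ring. Qed.

Lemma oct_mulA_ll a x : a ∘ (a ∘ x) = (a ∘ a) ∘ x.
Proof. by oct_case x; oct_case a; oct_ring. Qed.

Lemma oct_conjMK x y : oct_conj x ∘ (x ∘ y) = ⟨x, x⟩ *: y.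
Proof. by oct_case x; oct_case y; oct_ring. Qed.

Lemma oct_mul_conjK x y : x ∘ (oct_conj x ∘ y) = ⟨x, x⟩ *: y.
Proof. by oct_case x; oct_case y; oct_ring. Qed.

Lemma oct_conjM x : oct_conj x ∘ x = ⟨x, x⟩ *: 1o.
Proof. by oct_case x; oct_ring. Qed.

Lemma oct_dot_mulr x y a : ⟨x ∘ a, y ∘ a⟩ = ⟨a, a⟩ * ⟨x, y⟩.
Proof. by oct_case x; oct_case y; oct_case a; oct_ring. Qed.

Lemma oct_dot_mull x y a : ⟨a ∘ x, a ∘ y⟩ = ⟨a, a⟩ * ⟨x, y⟩.
Proof. by oct_case x; oct_case y; oct_case a; oct_ring. Qed.

(** This adjunction turns [J_u C ⊥ C] into the orthogonality of [u] to [conj x C] for every [x] in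
    [C]. *)
Lemma oct_dot_adj x u y : ⟨x ∘ u, y⟩ = ⟨u, oct_conj x ∘ y⟩.
Proof. by oct_case x; oct_case y; oct_case u; oct_ring. Qed.

Lemma oct_mul_imag a : oct_imag a -> a ∘ a = - ⟨a, a⟩ *: 1o.
Proof.
oct_case a; rewrite /oct_imag !oct_coordE.
rewrite !mul0r !addr0 mul1r => ->.
oct_ring.
Qed.

(** Source of the closed formula for the companion [oct_theta a]. *)
Lemma oct_conj_mul a x : oct_imag a ->
  (a ∘ x) ∘ a = - (⟨a, a⟩ *: oct_conj x + (2 * ⟨a, x⟩) *: a).
Proof.
oct_case a; oct_case x; rewrite /oct_imag !oct_coordE.
rewrite !mul0r !addr0 mul1r => ->.
oct_ring.
Qed.

Lemma oct_moufang v x a : ((v ∘ a) ∘ x) ∘ a = v ∘ ((a ∘ x) ∘ a).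
Proof. by oct_case v; oct_case a; oct_case x; oct_ring. Qed.

End Identities.

Section Spin7.
Variable R : realType.
Implicit Types (x y u v a : octonion R) (f g : 'End(octonion R)).
Implicit Types (C D L : {vspace octonion R}).

Local Notation "x ∘ y" := (oct_mul x y) (at level 40, left associativity).
Local Notation "⟨ x , y ⟩" := (oct_dot x y) (at level 0).
Local Notation "1o" := (oct_one R).

(** * Determinants, and closure of SO(8) and Spin(7) under composition *)

Definition oct_lmul a : 'End(octonion R) := linfun (oct_mul a).
Definition oct_rmul a : 'End(octonion R) := linfun (oct_J a).

Lemma oct_lmulE a x : oct_lmul a x = a ∘ x.
Proof. by rewrite lfunE. Qed.

Lemma oct_rmulE a x : oct_rmul a x = x ∘ a.
Proof. by rewrite lfunE. Qed.

Lemma dim_octonion : \dim {:octonion R} = 8%N.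
Proof. by rewrite dimvf. Qed.

(** The factors are swapped because the matrices act on row vectors. *)
Lemma oct_det_comp f g : oct_det (f \o g)%VF = oct_det g * oct_det f.
Proof.
rewrite /oct_det (passmx.mxof_comp _ _ (vbasisP _)).
exact: det_mulmx.
Qed.

Lemma oct_det1 : oct_det (\1 : 'End(octonion R))%VF = 1.
Proof. by rewrite /oct_det passmx.mxof1 ?det1 ?(basis_free (vbasisP _)). Qed.

Lemma oct_detZ k f : oct_det (k *: f) = k ^+ 8 * oct_det f.
Proof.
rewrite /oct_det; set e := vbasis _.
have -> : passmx.mxof e e (k *: f) = k *: passmx.mxof e e f.
  have mxof0 : passmx.mxof e e 0 = 0.
    have := passmx.mxof_linear e e (-1) 0 0.
    by rewrite scaler0 addr0 scaleN1r addNr.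
  by have := passmx.mxof_linear e e k f 0; rewrite mxof0 !addr0.
rewrite detZ; congr (_ ^+ _ * _); exact: dim_octonion.
Qed.

(* A complex structure [f] has positive determinant because
   [(1 + f)^2 = 2 f]. *)
Lemma oct_det_complex f : (f \o f)%VF = - \1%VF -> oct_det f = 1.
Proof.
move=> ff.
have sq : oct_det f * oct_det f = 1.
  rewrite -oct_det_comp ff -scaleN1r oct_detZ oct_det1.
  by rewrite -signr_odd expr0 mulr1.
have : oct_det ((\1 + f) \o (\1 + f))%VF = 2 ^+ 8 * oct_det f.
  rewrite -oct_detZ; congr oct_det.
  rewrite comp_lfunDl !comp_lfunDr !comp_lfun1l comp_lfun1r ff.
  by rewrite [X in _ + X]addrC addrACA addrN add0r -mulr2n scaler_nat.
rewrite oct_det_comp; set d := oct_det (_ + _) => dd.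
have : 0 <= d * d by rewrite -expr2 sqr_ge0.
nra.
Qed.

Lemma SO8_complex f : oct_isometry f -> (f \o f)%VF = - \1%VF -> SO8 f.
Proof. by move=> fi ff; split=> //; apply: oct_det_complex. Qed.

Lemma SO8_comp f g : SO8 f -> SO8 g -> SO8 (f \o g)%VF.
Proof.
move=> [fi fd] [gi gd]; split; first by move=> x y; rewrite !lfunE /= fi gi.
by rewrite oct_det_comp fd gd mulr1.
Qed.

Lemma SO8_1 : SO8 (\1 : 'End(octonion R))%VF.
Proof. by split; [move=> x y; rewrite !lfunE | exact: oct_det1]. Qed.

Lemma Spin7_comp f g : Spin7 f -> Spin7 g -> Spin7 (f \o g)%VF.
Proof.
move=> [fS [tf tfS fE]] [gS [tg tgS gE]]; split; first exact: SO8_comp.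
exists (tf \o tg)%VF; first exact: SO8_comp.
by move=> v x; rewrite !lfunE /= gE fE.
Qed.

Lemma Spin7_1 : Spin7 (\1 : 'End(octonion R))%VF.
Proof.
split; first exact: SO8_1.
by exists \1%VF; [exact: SO8_1 | move=> v x; rewrite !lfunE].
Qed.

(** * Multiplications by imaginary units, and the companions of right multiplications *)

Definition imag_unit a := oct_imag a /\ oct_unit a.

Lemma imag_unitN a : imag_unit a -> imag_unit (- a).
Proof.
by case=> ai au; rewrite /imag_unit /oct_imag /oct_unit oct_dotC !linearN /=
  ?[⟨- a, _⟩]oct_dotC ?linearN /= ?opprK ?ai ?oppr0.
Qed.

Lemma imag_unit_sqr a : imag_unit a -> a ∘ a = - 1o.
Proof. by case=> ai au; rewrite oct_mul_imag // au scaleN1r. Qed.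

Lemma SO8_rmul a : imag_unit a -> SO8 (oct_rmul a).
Proof.
move=> au; apply: SO8_complex.
  by move=> x y; rewrite !oct_rmulE oct_dot_mulr au.2 mul1r.
apply/lfunP => x; rewrite lfunE /= !oct_rmulE oct_mulA_rr imag_unit_sqr //.
by rewrite linearN /= oct_mulr1 !lfunE /= lfunE.
Qed.

Lemma SO8_lmul a : imag_unit a -> SO8 (oct_lmul a).
Proof.
move=> au; apply: SO8_complex.
  by move=> x y; rewrite !oct_lmulE oct_dot_mull au.2 mul1r.
apply/lfunP => x; rewrite lfunE /= !oct_lmulE oct_mulA_ll imag_unit_sqr //.
by rewrite oct_mulN1 !lfunE /= lfunE.
Qed.

(** The map [x ↦ - (a x) a], written as a composite of two complex structures when [a] is an
    imaginary unit, so that its determinant needs no separate computation. *)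
Definition oct_theta a : 'End(octonion R) := (oct_rmul a \o oct_lmul (- a))%VF.

Lemma oct_thetaE a x : imag_unit a ->
  oct_theta a x = (2 * ⟨1o, x⟩) *: 1o - x + (2 * ⟨a, x⟩) *: a.
Proof.
move=> [ai au]; rewrite /oct_theta comp_lfunE oct_rmulE oct_lmulE !oct_mulNl.
by rewrite oct_conj_mul // opprK au scale1r oct_conj_dot.
Qed.

Lemma SO8_theta a : imag_unit a -> SO8 (oct_theta a).
Proof.
by move=> au; apply: SO8_comp; [exact: SO8_rmul | exact/SO8_lmul/imag_unitN].
Qed.

Lemma rmul_theta a v x : imag_unit a ->
  oct_rmul a (v ∘ x) = oct_rmul a v ∘ oct_theta a x.
Proof.
(* Moufang is applied to [v a] because [(v a) a = - v], which makes the left side [- (v x) a]; the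
   sign is absorbed by [oct_theta]. *)
move=> au; have := oct_moufang (v ∘ a) x a.
rewrite oct_mulA_rr imag_unit_sqr // linearN /= oct_mulr1.
rewrite /oct_theta comp_lfunE !oct_rmulE oct_lmulE !oct_mulNl !linearN /=.
by move=> <-; rewrite opprK.
Qed.

Lemma Spin7_rmul a : imag_unit a -> Spin7 (oct_rmul a).
Proof.
move=> au; split; first exact: SO8_rmul.
by exists (oct_theta a); [exact: SO8_theta | move=> v x; rewrite rmul_theta].
Qed.

(** * Images under isometries, and Cayley subspaces *)

Lemma img_SO8_dim g C : SO8 g -> \dim (g @: C) = \dim C.
Proof.
move=> [gi _]; apply: limg_dim_eq; apply/eqP; rewrite -subv0.
apply/subvP => x; rewrite memv_cap memv_ker => /andP[_ /eqP gx].
by rewrite memv0 (@oct_dot_eq0 R x) // -gi gx linear0.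
Qed.

Lemma quat_spaceP x :
  reflect (exists a0 a1 a2 a3 : R, x = Oct a0 a1 a2 a3 0 0 0 0)
    (x \in quat_space R).
Proof.
rewrite mem_quat_space; apply: (iffP eqP) => [|[a0 [a1 [a2 [a3 ->]]]]].
  case: x => [[[a0 a1] [a2 a3]] y] /= ->.
  by exists a0, a1, a2, a3; rewrite unlock.
by rewrite unlock.
Qed.

Lemma dim_quat_space : \dim (quat_space R) = 4%N.
Proof.
rewrite /quat_space limg_dim_eq ?dimvf //; apply/eqP; rewrite -subv0.
apply/subvP => x; rewrite memv_cap memv_ker lfunE /= => /andP[_ /eqP [->]].
by rewrite memv0.
Qed.

Lemma cayley_quat_space : cayley (quat_space R).
Proof.
split; first exact: dim_quat_space.
by exists \1%VF; [exact: Spin7_1 | rewrite lim1g].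
Qed.

(** The inverse of [oct_rmul a] is [oct_rmul (- a)], again in Spin(7). This lets the reduction
    replace [C] by its image. *)
Lemma cayley_rmul a C : imag_unit a -> cayley (oct_rmul a @: C) -> cayley C.
Proof.
move=> au [dC [g gS gC]]; split.
  by rewrite -(img_SO8_dim C (SO8_rmul au)).
exists (oct_rmul (- a) \o g)%VF.
  exact/Spin7_comp/gS/Spin7_rmul/imag_unitN.
rewrite limg_comp -gC -limg_comp -[LHS]lim1g; congr (_ @: _)%VS.
apply/lfunP => x; rewrite comp_lfunE !oct_rmulE lfunE /= linearN /=.
by rewrite oct_mulA_rr imag_unit_sqr // linearN /= oct_mulr1 opprK.
Qed.

(** * Basis units, and the direction from Cayley to H-Lagrangian *)

Local Notation oi := (Oct (0 : R) 1 0 0 0 0 0 0).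
Local Notation oj := (Oct (0 : R) 0 1 0 0 0 0 0).
Local Notation ok := (Oct (0 : R) 0 0 1 0 0 0 0).
Local Notation oe := (Oct (0 : R) 0 0 0 1 0 0 0).

Lemma imag_unit_i : imag_unit oi.
Proof. by split; rewrite /oct_imag /oct_unit !oct_coordE; ring. Qed.

Lemma imag_unit_j : imag_unit oj.
Proof. by split; rewrite /oct_imag /oct_unit !oct_coordE; ring. Qed.

Lemma imag_unit_k : imag_unit ok.
Proof. by split; rewrite /oct_imag /oct_unit !oct_coordE; ring. Qed.

Lemma imag_unit_e : imag_unit oe.
Proof. by split; rewrite /oct_imag /oct_unit !oct_coordE; ring. Qed.

Lemma cayley_Hlagrangian C : cayley C -> Hlagrangian C.
Proof.
move=> [dC [g [gS [t tS gE]] ->]]; split.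
  by rewrite (img_SO8_dim _ gS) dim_quat_space.
have eu := imag_unit_e.
(* Cancel the unit vector [g 1] in [g 1 = g 1 (t 1)]. Being an isometry that fixes [1o], [t] then
   preserves the imaginary octonions. *)
have t1 : t 1o = 1o.
  have g1 : ⟨g 1o, g 1o⟩ = 1 by rewrite gS.1 !oct_coordE; ring.
  have := gE 1o 1o; rewrite oct_mulr1 => /(congr1 (oct_mul (oct_conj (g 1o)))).
  by rewrite oct_conjMK oct_conjM g1 !scale1r.
(* Since [(h, 0) (0, 1) = (0, h)], the inner image is [0 x H]. *)
exists (t @: (oct_rmul oe @: quat_space R))%VS; split.
- by rewrite (img_SO8_dim _ tS) (img_SO8_dim _ (SO8_rmul eu)) dim_quat_space.
- move=> _ /memv_imgP[_ /memv_imgP[_ /quat_spaceP[h0 [h1 [h2 [h3 ->]]]] ->] ->].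
  by rewrite /oct_imag -t1 tS.1 oct_rmulE !oct_coordE; ring.
move=> _ /memv_imgP[_ /memv_imgP[_ /quat_spaceP[h0 [h1 [h2 [h3 ->]]]] ->] ->] _.
move=> _ _ /memv_imgP[_ /quat_spaceP[x0 [x1 [x2 [x3 ->]]]] ->]
  /memv_imgP[_ /quat_spaceP[y0 [y1 [y2 [y3 ->]]]] ->].
(* The product [g x (t u)] is [g (x u)], so all reduces to [x u] in [0 x H] being orthogonal to [y]
   in [H x 0]. *)
by rewrite /oct_J -gE gS.1 oct_rmulE !oct_coordE; ring.
Qed.

(* For [C] H-Lagrangian with witness [L], such a [D] is the orthogonal
   complement of [L], i.e. [1] plus a three-dimensional space of imaginaries. *)
Definition rmul_stable C D :=
  [/\ 1o \in D, \dim D = 4%N & forall x d, x \in C -> d \in D -> x ∘ d \in C].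

(** * The stable space [D] of an H-Lagrangian subspace *)

Lemma exists_unit x : x != 0 -> exists2 k : R, k != 0 & oct_unit (k *: x).
Proof.
move=> x0; have n0 : 0 < ⟨x, x⟩.
  by rewrite lt_def oct_dot_ge0 andbT; apply: contra x0 => /eqP/oct_dot_eq0->.
exists (Num.sqrt ⟨x, x⟩)^-1; first by rewrite invr_eq0 sqrtr_eq0 -ltNge.
rewrite /oct_unit oct_dotZl oct_dotZr mulrA -invfM.
by rewrite -expr2 sqr_sqrtr ?ltW // mulVf // gt_eqF.
Qed.

(** The sum [D1 + D2] is orthogonal to [L], hence meets it trivially and has dimension at most 8 -
    4; both summands therefore fill it. *)
Lemma orthogonal_dim4 D1 D2 L :
  \dim D1 = 4%N -> \dim D2 = 4%N -> \dim L = 4%N ->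
  (forall x u, x \in D1 -> u \in L -> ⟨u, x⟩ = 0) ->
  (forall x u, x \in D2 -> u \in L -> ⟨u, x⟩ = 0) -> D1 = D2.
Proof.
move=> d1 d2 dL o1 o2.
have dis : ((D1 + D2) :&: L = 0)%VS.
  apply/eqP; rewrite -subv0; apply/subvP => x.
  rewrite memv_cap memv0 => /andP[/memv_addP[x1 x1D [x2 x2D ->]] xL].
  by apply/eqP/oct_dot_eq0; rewrite linearD /= o1 // o2 // addr0.
have dD : (\dim (D1 + D2) <= 4)%N.
  have := dimvS (subvf (D1 + D2 + L)).
  by rewrite dimv_disjoint_sum // dL dim_octonion (leq_add2r 4 _ 4).
have /eqP E1 : (D1 == D1 + D2)%VS by rewrite eqEdim addvSl d1.
have /eqP E2 : (D2 == D1 + D2)%VS by rewrite eqEdim addvSr d2.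
by rewrite E1 -E2.
Qed.

Lemma Hlagrangian_stable C : Hlagrangian C -> exists D, rmul_stable C D.
Proof.
move=> [dC [L [dL _ LC]]].
(* The hypothesis speaks of unit vectors of [L] only; rescaling extends it to all of [L]. *)
have ort u x y : u \in L -> x \in C -> y \in C -> ⟨x ∘ u, y⟩ = 0.
  have [-> _ _ _|u0] := eqVneq u 0; first by rewrite linear0 oct_dotC linear0.
  have [k k0 ku] := exists_unit u0 => uL xC yC.
  have := LC _ (memvZ k uL) ku x y xC yC; rewrite /oct_J linearZ /= oct_dotZl.
  by move=> /eqP; rewrite mulf_eq0 (negbTE k0) => /eqP.
pose E x := (oct_lmul (oct_conj x) @: C)%VS.
have dE x : x != 0 -> \dim (E x) = 4%N.
  move=> x0; rewrite /E limg_dim_eq //; apply/eqP; rewrite -subv0.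
  apply/subvP => y; rewrite memv_cap memv_ker oct_lmulE => /andP[_ /eqP h].
  have := oct_mul_conjK x y; rewrite h linear0 memv0 => /esym/eqP.
  rewrite scaler_eq0 => /orP[/eqP/oct_dot_eq0 x00|//].
  by rewrite x00 eqxx in x0.
have oE x z u : x \in C -> z \in E x -> u \in L -> ⟨u, z⟩ = 0.
  move=> xC /memv_imgP[y yC ->] uL.
  by rewrite oct_lmulE -oct_dot_adj ort.
have x0 : vpick C != 0 by rewrite vpick0 -dimv_eq0 dC.
set x := vpick C in x0; have xC : x \in C by exact: memv_pick.
have nx0 : ⟨x, x⟩ != 0 by apply: contra x0 => /eqP/oct_dot_eq0->.
exists (E x); split; first 1 last; [exact: dE| |].
- move=> y d yC; have [->|y0] := eqVneq y 0; first by rewrite oct_mul0 mem0v.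
  (* Both are four-dimensional and orthogonal to [L]. Once [d] is written [conj y w] with [w] in
     [C], the product [y d] is a multiple of [w]. *)
  have -> : E x = E y.
    by apply: (orthogonal_dim4 (dE _ x0) (dE _ y0) dL) => z u zE;
      [exact: oE xC zE | exact: oE yC zE].
  by move=> /memv_imgP[w wC ->]; rewrite oct_lmulE oct_mul_conjK memvZ.
have := memv_img (oct_lmul (oct_conj x)) xC.
by rewrite oct_lmulE oct_conjM => /(memvZ ⟨x, x⟩^-1); rewrite scalerK.
Qed.

(** * Moving [D] onto [H x 0] *)

(** Each vector of [s] imposes one linear equation, which lowers the dimension by at most one, so a
    nonzero vector survives. *)
Lemma exists_unit_orthogonal D (s : seq (octonion R)) : (size s < \dim D)%N ->
  exists d, [/\ d \in D, oct_unit d & forall t, t \in s -> ⟨t, d⟩ = 0].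
Proof.
elim: s D => [|t s IH] D sD.
  have d0 : vpick D != 0 by rewrite vpick0 -dimv_eq0 -lt0n.
  have [k _ ku] := exists_unit d0.
  by exists (k *: vpick D); rewrite memvZ ?memv_pick.
pose f : 'Hom(octonion R, R^o) :=
  linfun (oct_dot t : octonion R -> R^o).
have [|d [/memv_capP[dD]]] := IH (D :&: lker f)%VS.
  have /= := limg_ker_dim f D; have := dimvS (subvf (f @: D)).
  rewrite dimvf /= => h1 h2; move: sD; rewrite -h2 /= => sD.
  rewrite -(ltn_add2r 1) addn1; apply: leq_trans sD _.
  by rewrite leq_add2l.
rewrite memv_ker lfunE /= => /eqP td du sd; exists d; split=> // u.
by rewrite in_cons => /orP[/eqP->//|]; exact: sd.
Qed.

(** Unless [e] is already in [D], the pair [(C, D)] becomes [(R_a C, theta_a D)], which stays stable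
    because [R_a (x d) = R_a x (theta_a d)]. *)
Lemma rmul_stable_step C D (s : seq (octonion R)) e :
  rmul_stable C D -> (size s < 3)%N -> imag_unit e ->
  (forall t, t \in s -> [/\ t \in D, oct_imag t & ⟨t, e⟩ = 0]) ->
  exists C' D', [/\ rmul_stable C' D', \dim C' = \dim C,
    forall t, t \in e :: s -> t \in D' & cayley C' -> cayley C].
Proof.
move=> [D1 dD CD] s3 [ei eu] sP.
have [eD|eD] := boolP (e \in D).
  exists C, D; split=> // t; rewrite in_cons => /orP[/eqP->//|/sP[]//].
(* At most three vectors are to be avoided in a space of dimension four; including [1o] among them
   makes [j] imaginary. *)
have [|j [jD ju js]] := @exists_unit_orthogonal D (1o :: s).
  by rewrite dD.
have ji : oct_imag j by apply: js; rewrite mem_head.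
(* The companion of the normalised bisector [a] of [j] and [e] sends [j] to [e]
   and, being [-1] on [Im O] orthogonally to [a], preserves the span of [s]. *)
have je0 : j + e != 0.
  by apply: contraNneq eD => je; rewrite -(addKr j e) je addr0 memvN.
have [k k0 au] := exists_unit je0; set a := k *: _ in au.
have aE t : ⟨t, j⟩ = 0 -> ⟨t, e⟩ = 0 -> ⟨a, t⟩ = 0.
  by move=> tj te; rewrite oct_dotC oct_dotZr linearD /= tj te addr0 mulr0.
have aiu : imag_unit a by split=> //; rewrite /oct_imag oct_dotC aE.
have tD1 t : oct_imag t -> oct_theta a t = (2 * ⟨a, t⟩) *: a - t.
  by move=> ti; rewrite oct_thetaE // ti mulr0 scale0r add0r addrC.
exists (oct_rmul a @: C)%VS, (oct_theta a @: D)%VS; split.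
- split.
  + have <- : oct_theta a 1o = 1o.
      rewrite oct_thetaE // oct_dotC aiu.1 !mulr0 scale0r addr0.
      by oct_ring.
    exact: memv_img.
  + by rewrite (img_SO8_dim _ (SO8_theta aiu)).
  move=> _ _ /memv_imgP[x xC ->] /memv_imgP[d dD' ->].
  by rewrite -rmul_theta // memv_img ?CD.
- exact/img_SO8_dim/SO8_rmul.
- move=> t; rewrite in_cons => /orP[/eqP->|ts].
    have <- : oct_theta a j = e; last exact: memv_img.
    rewrite tD1 // /a scalerA oct_dotZl.
    (* As [j] and [e] are unit vectors, [2 ⟨j + e, j⟩] is the squared norm of [j + e], and [k]
       normalises [j + e]. *)
    suff -> : 2 * (k * ⟨j + e, j⟩) * k = 1 by rewrite scale1r addrC addKr.
    move: au; rewrite /a /oct_unit oct_dotZl oct_dotZr.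
    rewrite linearD /= !oct_dotDl ju eu (oct_dotC e j) => nu.
    by rewrite -[RHS]nu; ring.
  have [tD ti te] := sP t ts.
  have tj : ⟨t, j⟩ = 0 by apply: js; rewrite in_cons ts orbT.
  have <- : oct_theta a (- t) = t; last by rewrite memv_img ?memvN.
  by rewrite linearN /= tD1 // aE // mulr0 scale0r add0r opprK.
exact: cayley_rmul.
Qed.

(** The frame is built from the end of [s]: each step adds the head while keeping the tail in [D'],
    and the implications between Cayley properties compose. *)
Lemma rmul_stable_frame (s : seq (octonion R)) C D :
  rmul_stable C D -> (size s <= 3)%N -> (forall t, t \in s -> imag_unit t) ->
  pairwise (fun x y => ⟨x, y⟩ == 0) s ->
  exists C' D', [/\ rmul_stable C' D', \dim C' = \dim C,
    forall t, t \in s -> t \in D' & cayley C' -> cayley C].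
Proof.
elim: s => [|e s IH] st; first by exists C, D.
move=> s3 su; rewrite pairwise_cons => /andP[/allP es ps].
have [||//|C1 [D1 [st1 d1 s1 c1]]] := IH st; first exact: ltnW.
  by move=> t ts; apply: su; rewrite in_cons ts orbT.
have [//|||C2 [D2 [st2 d2 s2 c2]]] := @rmul_stable_step C1 D1 s e st1.
- exact/su/mem_head.
- move=> t ts; split; first exact: s1.
    by have [] := su t; rewrite ?in_cons ?ts ?orbT.
  by rewrite oct_dotC; apply/eqP/es.
by exists C2, D2; split; rewrite ?d2 //; move/c2/c1.
Qed.

(** * Subspaces stable under right multiplication by [H x 0] *)

Lemma quat_stable_cayley C D : \dim C = 4%N -> rmul_stable C D ->
  (quat_space R <= D)%VS -> cayley C.
Proof.
move=> dC [_ _ CD] /subvP HD.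
have {}CD x h : x \in C -> h \in quat_space R -> x ∘ h \in C.
  by move=> xC /HD; exact: CD.
have eu := imag_unit_e.
(* Since [(h, k) (0, 1) = (- k, h)], the inclusion says that [C] lies in [0 x H]. Otherwise some [x]
   in [C] has a nonzero first component [y]. *)
have [sub|] := boolP (oct_rmul oe @: C <= quat_space R)%VS.
  apply: (cayley_rmul eu); suff -> : (oct_rmul oe @: C = quat_space R)%VS.
    exact: cayley_quat_space.
  apply/eqP; rewrite eqEdim sub (img_SO8_dim _ (SO8_rmul eu)) dC.
  by rewrite dim_quat_space.
case/subvPn => _ /memv_imgP[x xC ->].
case: (octP x) xC => x0 x1 x2 x3 x4 x5 x6 x7 xC; rewrite oct_rmulE => xe.
pose y := Oct x0 x1 x2 x3 0 0 0 0.
have yC : y \in C.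
  have iH : oi \in quat_space R by apply/quat_spaceP; exists 0, 1, 0, 0.
  have jH : oj \in quat_space R by apply/quat_spaceP; exists 0, 0, 1, 0.
  have kH : ok \in quat_space R by apply/quat_spaceP; exists 0, 0, 0, 1.
  set z := Oct _ _ _ _ _ _ _ _ in xC.
  (* Multiplying on the right by [i], [j], [k] in turn negates [H x 0] and fixes [0 x H], so the
     difference is twice the first component. *)
  suff -> : y = 2^-1 *: (z - z ∘ oi ∘ oj ∘ ok).
    by rewrite memvZ // memvB // !CD.
  by rewrite !oct_coordE; congr Oct; field.
have y0 : ⟨y, y⟩ != 0.
  apply: contraNneq xe => /oct_dot_eq0 yz.
  have -> : Oct x0 x1 x2 x3 x4 x5 x6 x7 ∘ oe =
      y ∘ oe + Oct (- x4) (- x5) (- x6) (- x7) 0 0 0 0.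
    by oct_ring.
  rewrite yz oct_mul0 add0r; apply/quat_spaceP.
  by exists (- x4), (- x5), (- x6), (- x7).
suff <- : quat_space R = C by exact: cayley_quat_space.
apply/eqP; rewrite eqEdim dC dim_quat_space andbT; apply/subvP => h hH.
(* Every [h] in [H x 0] is a right multiple of [y] by the quaternion [conj y h], up to a scalar, so
   [H x 0] lies in [C]. *)
have -> : h = ⟨y, y⟩^-1 *: (y ∘ (oct_conj y ∘ h)).
  by rewrite oct_mul_conjK scalerK.
apply/memvZ/CD => //; apply/quat_spaceP.
have /quat_spaceP[h0 [h1 [h2 [h3 ->]]]] := hH.
rewrite !oct_coordE; eexists; eexists; eexists; eexists.
by congr Oct; ring.
Qed.

Lemma Hlagrangian_cayley C : Hlagrangian C -> cayley C.
Proof.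
move=> HC; have [D st] := Hlagrangian_stable HC; case: HC => dC _.
have [|||C' [D' [st' dC' sub cC]]] := @rmul_stable_frame [:: oi; oj; ok] C D st.
- by [].
- move=> t; rewrite !inE => /or3P[] /eqP->.
  + exact: imag_unit_i.
  + exact: imag_unit_j.
  exact: imag_unit_k.
- by rewrite /= !oct_coordE !(mul0r, mulr0, mul1r, addr0) eqxx.
apply: cC; apply: (quat_stable_cayley _ st'); first by rewrite dC'.
apply/subvP => _ /quat_spaceP[h0 [h1 [h2 [h3 ->]]]].
have -> : Oct h0 h1 h2 h3 0 0 0 0 = h0 *: 1o + h1 *: oi + h2 *: oj + h3 *: ok.
  by oct_ring.
have [D'1 _ _] := st'.
have /sub iD : oi \in [:: oi; oj; ok] by exact: mem_head.
have /sub jD : oj \in [:: oi; oj; ok] by exact/mem_behead/mem_head.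
have /sub kD : ok \in [:: oi; oj; ok].
  by do 2 apply: mem_behead; exact: mem_head.
apply: memvD; last exact: memvZ.
apply: memvD; last exact: memvZ.
by apply: memvD; exact: memvZ.
Qed.

End Spin7.

Theorem corollary18 (R : realType) (C : {vspace octonion R}) :
  \dim C = 4%N -> (Hlagrangian C <-> cayley C).
Proof.
by move=> _; split; [exact: Hlagrangian_cayley | exact: cayley_Hlagrangian].
Qed.
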